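(* Let $\mathcal{H}$ be a complex Hilbert space, let $T \in B(\mathcal{H})$, and let $N(\cdot)$ be a norm on $B(\mathcal{H})$. Then $$dw_N(T) \geq \frac12 \sqrt{\frac34 N^2(T) + 2N^4(|T|) + (d_1 + d_2) + 2|m_1 - m_2|},$$ where $$m_1 = \max\{N^2(\Re(T)) + N^4(|T|),\ w_N^2(T)\}, \qquad m_2 = \max\{N^2(\Im(T)),\ N^4(|T|)\},$$ $$d_1 = |N^2(\Re(T)) + N^4(|T|) - w_N^2(T)|, \qquad d_2 = |N^2(\Im(T)) - N^4(|T|)|.$$
   Context: $B(\mathcal{H})$ is the $C^*$-algebra of bounded linear operators on the complex Hilbert space $\mathcal{H}$. For $T \in B(\mathcal{H})$, $T^*$ is the adjoint, $|T| = (T^*T)^{1/2}$, $\Re(T) = \frac12(T + T^* )$ and $\Im(T) = \frac{1}{2i}(T - T^* )$. $N(\cdot)$ is an arbitrary norm on $B(\mathcal{H})$ (as a complex vector space), not necessarily the operator norm; $N^k(X)$ means $(N(X))^k$ and $w_N^2(T)$ means $(w_N(T))^2$. The generalized numerical radius is $w_N(T) = \sup_{\theta \in \mathbb{R}} N(\Re(e^{i\theta}T))$. The generalized Davis--Wielandt radius is $dw_N(T) = \sup_{\theta \in \mathbb{R}} \sqrt{N^2(\Re(e^{i\theta}T)) + N^4(\Re(e^{i\theta}|T|))}$. *)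

(* Defs.v *)
From HB Require Import structures.
From mathcomp Require Import all_boot all_order all_algebra.
From mathcomp Require Import sesquilinear.
From mathcomp Require Import complex.
From mathcomp Require Import boolp classical_sets functions reals.
From mathcomp Require Import topology normedtype trigo.

Set Implicit Arguments.
Unset Strict Implicit.
Unset Printing Implicit Defensive.

Import Order.TTheory GRing.Theory Num.Theory.
Import numFieldNormedType.Exports.
Local Open Scope classical_set_scope.
Local Open Scope ring_scope.
Local Open Scope complex_scope.

(* The inner product is linear in its first argument and conjugate-linear in
   the second; norms of vectors take values in R[i] (in its nonnegative reals). *)
HB.mixin Record CompleteNormedModule_isHilbert (R : realType) H
    of CompleteNormedModule R[i] H := {
  inner : {dot H for @Num.conj R[i]};
  inner_norm : forall x : H, inner x x = `|x| ^+ 2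
}.

#[short(type="hilbertType")]
HB.structure Definition Hilbert (R : realType) :=
  {H of CompleteNormedModule R[i] H & CompleteNormedModule_isHilbert R H}.

Section BoundedOperators.
Variables (R : realType) (H : hilbertType R).

Definition bounded_linear : {pred H -> H} :=
  [pred f | `[< linear f /\ exists M : R, forall x, `|f x| <= M%:C * `|x| >]].

Lemma bounded_linear_submod_closed : submod_closed bounded_linear.
Proof.
split=> [|a f g /asboolP[lf [M fM]] /asboolP[lg [L gL]]]; apply/asboolP; split.
- by move=> k x y; rewrite /= scaler0 addr0.
- by exists 0 => x; rewrite normr0 mul0r.
- move=> k x y; have E z : (a *: f + g) z = a *: f z + g z by [].
  rewrite !E lf lg !scalerDr !scalerA [a * k]mulrC -!addrA.
  by congr (_ + _); rewrite addrCA.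
- exists (Normc.normc a * M + L) => x.
  apply: (le_trans (ler_normD _ _)); rewrite normrZ.
  rewrite rmorphD rmorphM mulrDl lerD// -mulrA.
  have -> : `|a| = (Normc.normc a)%:C by [].
  by rewrite ler_wpM2l// lecR; case: (a) => ? ?; rewrite sqrtr_ge0.
Qed.

HB.instance Definition _ := GRing.isSubmodClosed.Build R[i] (H -> H)
  bounded_linear bounded_linear_submod_closed.

Record bop := Bop { bop_fun :> H -> H; bop_subproof : bop_fun \in bounded_linear }.

HB.instance Definition _ := [isSub for bop_fun].
HB.instance Definition _ := [Choice of bop by <:].
HB.instance Definition _ := [SubChoice_isSubLmodule of bop by <:].

Lemma bounded_linear_comp (S T : bop) : S \o T \in bounded_linear.
Proof.
case: S T => [f /asboolP[lf [M fM]]] [g /asboolP[lg [L gL]]] /=.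
apply/asboolP; split=> [k x y|]; first by rewrite /= lg lf.
exists (`|M| * L) => x /=; apply: (le_trans (fM _)).
rewrite rmorphM /= -mulrA; apply: (@le_trans _ _ (`|M|%:C * `|g x|)).
  by rewrite ler_wpM2r// lecR ler_norm.
by rewrite ler_wpM2l// lecR normr_ge0.
Qed.

Definition bcomp (S T : bop) : bop := Bop (bounded_linear_comp S T).

Definition is_adjoint (T S : bop) :=
  forall x y : H, inner (T x) y = inner x (S y).

(* Bounded operators on a Hilbert space have exactly one adjoint, so that the
   default value 0 is never used; likewise for the square root below. *)
Definition adjoint (T : bop) : bop := xget 0 [set S | is_adjoint T S].

(* In the order of R[i], 0 <= z means that z is real and nonnegative. *)
Definition positive_op (T : bop) := forall x : H, 0 <= inner (T x) x.

Definition sqrt_op (T : bop) : bop :=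
  xget 0 [set S | positive_op S /\ bcomp S S = T].

Definition abs_op (T : bop) : bop := sqrt_op (bcomp (adjoint T) T).

Definition Re_op (T : bop) : bop := 2^-1 *: (T + adjoint T).

Definition Im_op (T : bop) : bop := (2 * 'i)^-1 *: (T - adjoint T).

(* Homogeneity uses the real-valued modulus normc of a complex number. *)
Record is_norm (N : bop -> R) : Prop := IsNorm {
  norm_triangle : forall S T, N (S + T) <= N S + N T;
  norm_homogeneous : forall (c : R[i]) T, N (c *: T) = Normc.normc c * N T;
  norm_definite : forall T, N T = 0 -> T = 0
}.

Definition expi (t : R) : R[i] := cos t +i* sin t.

(* sup is the total supremum on R; when N is a norm, the sets below are
   nonempty and bounded, so it is their least upper bound. *)
Definition num_radius (N : bop -> R) (T : bop) : R :=
  sup (range (fun t : R => N (Re_op (expi t *: T)))).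

Definition dw_radius (N : bop -> R) (T : bop) : R :=
  sup (range (fun t : R =>
    Num.sqrt (N (Re_op (expi t *: T)) ^+ 2
              + N (Re_op (expi t *: abs_op T)) ^+ 4))).

End BoundedOperators.

(* Main.v *)
Require Import Defs.
From HB Require Import structures.
From mathcomp Require Import all_boot all_order all_algebra.
From mathcomp Require Import sesquilinear.
From mathcomp Require Import complex.
From mathcomp Require Import boolp classical_sets functions reals.
From mathcomp Require Import topology normedtype trigo.
From mathcomp Require Import ring lra.

Import Order.TTheory GRing.Theory Num.Theory.
Import numFieldNormedType.Exports.
Local Open Scope ring_scope.

(** Write [a], [b], [p], [n] for the [N]-norms of [Re T], [Im T], [|T|] and [T],
    [w] for the numerical radius and [D] for the Davis-Wielandt radius.

    Two angles in the supremum that defines [D] carry the argument.  Angle [0]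
    gives [a ^+ 2 + p ^+ 4 <= D ^+ 2], since [|T|] is self-adjoint and hence its
    own real part; angle [pi / 2] gives [b ^+ 2 <= D ^+ 2], since
    [Re (i T) = - Im T].  Dropping the second term under the root also gives
    [w <= D].  So each of the four numbers [a ^+ 2 + p ^+ 4], [w ^+ 2], [b ^+ 2]
    and [p ^+ 4] is at most [D ^+ 2], and therefore so is [max m1 m2].

    Applying [2 max (x, y) = x + y + |x - y|] to [m1] and [m2], and then to the
    maximum of these two, yields
      [4 D ^+ 2 >= 4 max m1 m2 = 2 m1 + 2 m2 + 2 |m1 - m2|
                = a ^+ 2 + b ^+ 2 + w ^+ 2 + 2 p ^+ 4 + d1 + d2 + 2 |m1 - m2|],
    and [a ^+ 2 + b ^+ 2 + w ^+ 2 >= 3 / 4 * n ^+ 2] ([sqr_norm_le]) finishes: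
    the Cartesian decomposition [T = Re T + i Im T] gives [n <= a + b], whence
    [a ^+ 2 + b ^+ 2 >= n ^+ 2 / 2], and [a, b <= w] gives [w >= n / 2].

    The operator theory behind this is the rule
    [adjoint (c T) = c^* adjoint T] and the fact that positive operators on a
    complex space are self-adjoint. *)

Section Operators.
Set Implicit Arguments.
Unset Strict Implicit.
Context {R : realType} {H : hilbertType R}.
Implicit Types (S T : bop H) (c : R[i]) (x y : H).

(** * Inner products and bounded operators *)

Lemma innerDl x y z : inner (x + y) z = inner x z + inner y z.
Proof. exact: linearDl. Qed.

Lemma innerDr x y z : inner x (y + z) = inner x y + inner x z.
Proof. exact: linearDr. Qed.

Lemma innerBr x y z : inner x (y - z) = inner x y - inner x z.
Proof. exact: linearBr. Qed.

Lemma innerZl c x y : inner (c *: x) y = c * inner x y.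
Proof. exact: linearZl_LR. Qed.

Lemma innerZr c x y : inner x (c *: y) = c^* * inner x y.
Proof. exact: linearZr_LR. Qed.

Lemma innerC x y : inner x y = (inner y x)^*.
Proof. by rewrite hermC expr0 mul1r. Qed.

Lemma bopD T x y : T (x + y) = T x + T y.
Proof.
have /asboolP[lT _] := bop_subproof T.
by have := lT 1 x y; rewrite !scale1r.
Qed.

Lemma bop0 T : T 0 = 0.
Proof. by apply: (addrI (T 0)); rewrite -bopD !addr0. Qed.

Lemma bopZ T c x : T (c *: x) = c *: T x.
Proof.
have /asboolP[lT _] := bop_subproof T.
by have := lT c x 0; rewrite !addr0 bop0 addr0.
Qed.

(** * Adjoints *)

(** The difference of the two values at [y] is orthogonal to every vector, in
    particular to itself. *)
Lemma is_adjoint_unique T S S' : is_adjoint T S -> is_adjoint T S' -> S = S'.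
Proof.
move=> TS TS'; apply: val_inj; apply/funext => y /=.
apply: subr0_eq.
have /eqP : `|S y - S' y| ^+ 2 = 0.
  by rewrite -inner_norm innerBr -TS -TS' subrr.
by rewrite sqrf_eq0 normr_eq0 => /eqP.
Qed.

Lemma adjointE T S : is_adjoint T S -> adjoint T = S.
Proof.
by move=> TS; apply: xget_unique => // S' TS'; exact: is_adjoint_unique TS' TS.
Qed.

Lemma is_adjointZ c T S : is_adjoint T S -> is_adjoint (c *: T) (c^* *: S).
Proof. by move=> TS x y /=; rewrite innerZl innerZr conjCK TS. Qed.

Lemma adjoint0 : adjoint (0 : bop H) = 0.
Proof. by apply: adjointE => x y; rewrite /= linear0l linear0r. Qed.

(** For nonzero [c], taking conjugate multiples is a bijection from the
    adjoints of [T] to those of [c T]; so [c T] has one exactly when [T] has, and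
    otherwise both sides are the default value [0]. *)
Lemma adjointZ c T : adjoint (c *: T) = c^* *: adjoint T.
Proof.
have [->|c0] := eqVneq c 0; first by rewrite conjC0 !scale0r adjoint0.
have [[S TS]|noS] := pselect (exists S, is_adjoint T S).
  by rewrite (adjointE TS) (adjointE (is_adjointZ c TS)).
have adjoint_default T' : (forall S, ~ is_adjoint T' S) -> adjoint T' = 0.
  exact: xgetPN.
rewrite !adjoint_default ?scaler0// => S TS; apply: noS; first by exists S.
by exists (c^-1^* *: S); rewrite -[T](scalerK c0); exact: is_adjointZ.
Qed.

(** * Real and imaginary parts *)

Lemma half_double T : 2^-1 *: (T + T) = T.
Proof.
by rewrite -mulr2n -[T *+ 2]scaler_nat scalerA mulVf ?pnatr_eq0// scale1r.
Qed.

Lemma Re_opZ c T : Re_op (c *: T) = 2^-1 *: (c *: T + c^* *: adjoint T).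
Proof. by rewrite /Re_op adjointZ. Qed.

Lemma Re_Im_op T : T = Re_op T + 'i *: Im_op T.
Proof.
rewrite /Re_op /Im_op scalerA invfM mulrCA mulfV ?neq0Ci// mulr1 -scalerDr.
by rewrite addrACA subrr addr0 half_double.
Qed.

Lemma Re_op_mul_i T : Re_op ('i *: T) = - Im_op T.
Proof.
rewrite Re_opZ conjCi scaleNr -scalerBr scalerA /Im_op -scaleNr; congr (_ *: _).
by rewrite invfM invCi mulrN opprK.
Qed.

(** Polarization: positivity makes [inner (T u) u] real, so the sesquilinear
    form [h], the defect of self-adjointness, vanishes on the diagonal.  This
    makes [h] antisymmetric; replacing [y] by [i y], which is where complex
    scalars enter, makes it symmetric as well, hence zero. *)
Lemma positive_is_adjoint T : positive_op T -> is_adjoint T T.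
Proof.
move=> T_ge0 x y; apply: subr0_eq.
pose h u v := inner (T u) v - inner u (T v).
have hdiag u : h u u = 0.
  have /ger0_real/CrealP := T_ge0 u.
  by rewrite -innerC /h => ->; rewrite subrr.
have hanti u v : h u v + h v u = 0.
  transitivity (h (u + v) (u + v) - h u u - h v v).
    by rewrite /h !bopD !innerDl !innerDr; ring.
  by rewrite !hdiag !subr0.
have hZr c u v : h u (c *: v) = c^* * h u v.
  by rewrite /h bopZ !innerZr mulrBr.
have hZl c u v : h (c *: u) v = c * h u v.
  by rewrite /h bopZ !innerZl mulrBr.
have hsym : h y x = h x y.
  have := hanti x ('i *: y); rewrite hZr hZl conjCi mulNr addrC => /subr0_eq.
  by move/(mulfI (neq0Ci _)).
by have /eqP := hanti x y; rewrite hsym -mulr2n mulrn_eq0 /= => /eqP.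
Qed.

(** A chosen square root is positive by specification, and so is the default
    value [0]; hence self-adjointness of [|T|] follows from positivity alone. *)
Lemma abs_op_positive T : positive_op (abs_op T).
Proof.
rewrite /abs_op /sqrt_op; case: xgetP => [S _ []//|_ x].
by rewrite /= linear0l.
Qed.

Lemma adjoint_abs_op T : adjoint (abs_op T) = abs_op T.
Proof. exact/adjointE/positive_is_adjoint/abs_op_positive. Qed.

(** * Phases *)

Lemma expi0 : expi 0 = 1 :> R[i].
Proof. by rewrite /expi cos0 sin0. Qed.

Lemma expi_pihalf : expi (pi / 2) = 'i :> R[i].
Proof. by rewrite /expi cos_pihalf sin_pihalf -complexiE. Qed.

Lemma normc_expi (t : R) : Normc.normc (expi t) = 1.
Proof. by rewrite /= cos2Dsin2 sqrtr1. Qed.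

Lemma normc_conj c : Normc.normc c^* = Normc.normc c.
Proof. by case: c => a b /=; rewrite sqrrN. Qed.

(** * Norms and radii *)

Section Norm.
Context {N : bop H -> R} (hN : is_norm N).

Lemma norm0 : N 0 = 0.
Proof. by rewrite -(scale0r 0) (norm_homogeneous hN) Normc.normc0 mul0r. Qed.

Lemma norm_phase c T : Normc.normc c = 1 -> N (c *: T) = N T.
Proof. by move=> c1; rewrite (norm_homogeneous hN) c1 mul1r. Qed.

Lemma normN T : N (- T) = N T.
Proof.
rewrite -scaleN1r norm_phase//.
by rewrite /= oppr0 sqrrN expr1n expr0n addr0 sqrtr1.
Qed.

Lemma norm_ge0 T : 0 <= N T.
Proof.
have := norm_triangle hN T (- T).
by rewrite subrr norm0 normN; lra.
Qed.

Lemma norm_i T : N ('i *: T) = N T.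
Proof. by rewrite norm_phase// -expi_pihalf normc_expi. Qed.

Lemma norm_le_Re_Im T : N T <= N (Re_op T) + N (Im_op T).
Proof. by rewrite -(norm_i (Im_op T)) {1}(Re_Im_op T); exact: norm_triangle. Qed.

(** A bound independent of the angle: it makes the suprema defining both radii
    genuine upper bounds. *)
Lemma norm_Re_expi_le T (t : R) :
  N (Re_op (expi t *: T)) <= N T + N (adjoint T).
Proof.
rewrite Re_opZ (norm_homogeneous hN).
have -> : Normc.normc (2^-1 : R[i]) = 2^-1.
  rewrite Normc.normcV; congr _^-1.
  by rewrite /= addr0 expr0n addr0 sqrtr_sqr -mulr2n ger0_norm // ler0n.
have := norm_triangle hN (expi t *: T) ((expi t)^* *: adjoint T).
rewrite !norm_phase ?normc_conj ?normc_expi//.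
by have := norm_ge0 T; have := norm_ge0 (adjoint T); lra.
Qed.

Lemma num_radius_ge T (t : R) : N (Re_op (expi t *: T)) <= num_radius N T.
Proof.
apply: ub_le_sup; last by exists t.
by exists (N T + N (adjoint T)) => _ [s _ <-]; exact: norm_Re_expi_le.
Qed.

Lemma dw_radius_ge T (t : R) :
  Num.sqrt (N (Re_op (expi t *: T)) ^+ 2
            + N (Re_op (expi t *: abs_op T)) ^+ 4) <= dw_radius N T.
Proof.
apply: ub_le_sup; last by exists t.
exists (Num.sqrt ((N T + N (adjoint T)) ^+ 2
                  + (N (abs_op T) + N (adjoint (abs_op T))) ^+ 4)).
move=> _ [s _ <-]; apply: ler_wsqrtr.
by apply: lerD; apply: lerXn2r;
  rewrite ?nnegrE ?addr_ge0 ?norm_ge0 ?norm_Re_expi_le.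
Qed.

Lemma dw_radius_ge0 T : 0 <= dw_radius N T.
Proof. exact: le_trans (sqrtr_ge0 _) (dw_radius_ge T 0). Qed.

Lemma sqr_dw_radius_ge T (t : R) :
  N (Re_op (expi t *: T)) ^+ 2 + N (Re_op (expi t *: abs_op T)) ^+ 4
    <= dw_radius N T ^+ 2.
Proof.
rewrite -(@sqr_sqrtr _ (_ + _)) ?addr_ge0 ?exprn_ge0 ?norm_ge0//.
by rewrite lerXn2r ?nnegrE ?sqrtr_ge0 ?dw_radius_ge0 ?dw_radius_ge.
Qed.

Lemma num_radius_le_dw_radius T : num_radius N T <= dw_radius N T.
Proof.
apply: ge_sup; first by exists (N (Re_op (expi 0 *: T))), 0.
move=> _ [t _ <-]; apply: le_trans (dw_radius_ge T t).
rewrite -[leLHS]ger0_norm ?norm_ge0// -sqrtr_sqr ler_wsqrtr// lerDl.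
by rewrite exprn_ge0 ?norm_ge0.
Qed.

Lemma norm_Re_le_num_radius T : N (Re_op T) <= num_radius N T.
Proof. by have := num_radius_ge T 0; rewrite expi0 scale1r. Qed.

Lemma norm_Im_le_num_radius T : N (Im_op T) <= num_radius N T.
Proof.
by have := num_radius_ge T (pi / 2); rewrite expi_pihalf Re_op_mul_i normN.
Qed.

Lemma sqr_norm_Re_le_dw_radius T :
  N (Re_op T) ^+ 2 + N (abs_op T) ^+ 4 <= dw_radius N T ^+ 2.
Proof.
have Re_abs : Re_op (abs_op T) = abs_op T.
  by rewrite /Re_op adjoint_abs_op half_double.
by have := sqr_dw_radius_ge T 0; rewrite expi0 !scale1r Re_abs.
Qed.

Lemma sqr_norm_Im_le_dw_radius T : N (Im_op T) ^+ 2 <= dw_radius N T ^+ 2.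
Proof.
have := sqr_dw_radius_ge T (pi / 2); rewrite expi_pihalf !Re_op_mul_i !normN.
by apply: le_trans; rewrite lerDl exprn_ge0 ?norm_ge0.
Qed.

(** The first two terms contribute [1 / 2], by the parallelogram identity and
    [N T <= N (Re_op T) + N (Im_op T)]; the third contributes [1 / 4], because both
    parts are bounded by the radius and so [N T] is at most twice it. *)
Lemma sqr_norm_le T :
  3 / 4 * N T ^+ 2
    <= N (Re_op T) ^+ 2 + N (Im_op T) ^+ 2 + num_radius N T ^+ 2.
Proof.
have := norm_le_Re_Im T; have := norm_ge0 T.
have := norm_ge0 (Re_op T); have := norm_ge0 (Im_op T).
have := norm_Re_le_num_radius T; have := norm_Im_le_num_radius T.
move: (N T) (N (Re_op T)) (N (Im_op T)) (num_radius N T) => n a b w.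
move=> bw aw b0 a0 n0 nab.
have : n ^+ 2 <= (a + b) ^+ 2 by rewrite lerXn2r ?nnegrE ?addr_ge0.
have : (a + b) ^+ 2 <= (w + w) ^+ 2 by rewrite lerXn2r ?nnegrE; lra.
have := sqr_ge0 (a - b).
by nra.
Qed.

End Norm.
End Operators.

Theorem theorem5 (R : realType) (H : hilbertType R) (N : bop H -> R)
    (hN : is_norm N) (T : bop H) :
  let m1 := Num.max (N (Re_op T) ^+ 2 + N (abs_op T) ^+ 4)
                    (num_radius N T ^+ 2) in
  let m2 := Num.max (N (Im_op T) ^+ 2) (N (abs_op T) ^+ 4) in
  let d1 := `|N (Re_op T) ^+ 2 + N (abs_op T) ^+ 4 - num_radius N T ^+ 2| in
  let d2 := `|N (Im_op T) ^+ 2 - N (abs_op T) ^+ 4| in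
  dw_radius N T >=
    1 / 2 * Num.sqrt (3 / 4 * N T ^+ 2 + 2 * N (abs_op T) ^+ 4
                      + (d1 + d2) + 2 * `|m1 - m2|).
Proof.
(* The coercion to Prop is outside the let block and hinders introduction. *)
lazy zeta.
set d1 := `|_ + _ - num_radius N T ^+ 2|.
set d2 := `|N (Im_op T) ^+ 2 - _|.
set m1 := Num.max (_ + _) _.
set m2 := Num.max (N (Im_op T) ^+ 2) _.
have D0 : 0 <= dw_radius N T := dw_radius_ge0 hN T.
have w0 : 0 <= num_radius N T.
  exact: le_trans (norm_ge0 hN _) (norm_Re_le_num_radius hN T).
have reD := sqr_norm_Re_le_dw_radius hN T.
have imD := sqr_norm_Im_le_dw_radius hN T.
have absD : N (abs_op T) ^+ 4 <= dw_radius N T ^+ 2.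
  by apply: le_trans reD; rewrite lerDr sqr_ge0.
have wD : num_radius N T ^+ 2 <= dw_radius N T ^+ 2.
  by rewrite lerXn2r ?nnegrE// num_radius_le_dw_radius.
have m1D : m1 <= dw_radius N T ^+ 2 by rewrite ge_max reD wD.
have m2D : m2 <= dw_radius N T ^+ 2 by rewrite ge_max imD absD.
have maxD : Num.max m1 m2 <= dw_radius N T ^+ 2 by rewrite ge_max m1D m2D.
have m1E : 2 * m1 =
    N (Re_op T) ^+ 2 + N (abs_op T) ^+ 4 + num_radius N T ^+ 2 + d1.
  by rewrite /m1 maxr_absE mulrC divfK ?pnatr_eq0.
have m2E : 2 * m2 = N (Im_op T) ^+ 2 + N (abs_op T) ^+ 4 + d2.
  by rewrite /m2 maxr_absE mulrC divfK ?pnatr_eq0.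
have maxE : 2 * Num.max m1 m2 = m1 + m2 + `|m1 - m2|.
  by rewrite maxr_absE mulrC divfK ?pnatr_eq0.
have nT := sqr_norm_le hN T.
rewrite div1r mulrC ler_pdivrMr// -[leRHS]ger0_norm ?mulr_ge0//.
rewrite -[leRHS]sqrtr_sqr; apply: ler_wsqrtr; rewrite exprMn; lra.
Qed.
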